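(* Let $P(\partial)=\sum_{|\alpha|\le m}c_\alpha\partial^\alpha$ (with $m\in\mathbb N$, $\alpha\in\mathbb N^d$, $c_\alpha\in\mathbb R$) be a linear constant coefficient partial differential operator on $\mathbb R^d$. If $E\in D'$ is a (nonstandard) fundamental solution for $P(\partial)$ and $f\in\mathcal C^\infty_c$, then $v:=\operatorname{st}(E\star f)\in\mathcal C^\infty$ is a solution of $P(\partial)v=f$.
   Context: Work in Robinson's nonstandard analysis; ${}^*$ denotes the nonstandard extension. The extension of a standard function $f$ is again written $f$, $\partial^\alpha$ and $\int$ also denote their nonstandard extensions, and $\mathcal C^k\subseteq{}^*\mathcal C^k$ via extension. $\mathcal C^k$ ($k\in\mathbb N\cup\{\infty\}$) is the set of functions $\mathbb R^d\to\mathbb R$ with continuous partial derivatives up to order $k$; $\mathcal C^k_c$ is the subset of those with compact support; $\mathcal C=\mathcal C^0$. For $x,y\in{}^*\mathbb R^d$, $x\approx y$ means $x-y$ is infinitesimal; $x$ is finite if $|x|\le R$ for some $R\in\mathbb R$; ${}^*\mathbb R^d_\infty$ is the set of non-finite elements. For $g,h\in{}^*\mathcal C^\infty$: $g\approx_{\mathcal C^\infty}h$ means $\partial^\alpha g(x)\approx\partial^\alpha h(x)$ for all finite $x\in{}^*\mathbb R^d$ and all (standard) $\alpha\in\mathbb N^d$; $g\approx_{\mathcal C^\infty_c}h$ means $g\approx_{\mathcal C^\infty}h$ and $g(x)=h(x)$ for all $x\in{}^*\mathbb R^d_\infty$. We call $\phi\in{}^*\mathcal C^\infty$ $\mathcal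 C^\infty_c$-nearstandard if $\phi\approx_{\mathcal C^\infty_c}g$ for some standard $g\in\mathcal C^\infty_c$. $D'$ is the set of all $f\in{}^*\mathcal C^\infty$ such that $\int_{{}^*\mathbb R^d}f\phi$ is finite for every $\mathcal C^\infty_c$-nearstandard $\phi$. A (nonstandard) delta function is a $\delta\in{}^*\mathcal C^\infty$ such that $\int f\delta\approx f(0)$ for each $\mathcal C^\infty_c$-nearstandard $f$. $E\in{}^*\mathcal C^\infty$ is a fundamental solution for $P(\partial)$ if $P(\partial)E$ is a delta function. Convolution is $(f\star g)(x)=\int f(x-y)g(y)\,dy$, extended by transfer. A function $f:{}^*\mathbb R^d\to{}^*\mathbb R$ is S-continuous at $x$ if $f(y)\approx f(x)$ for all $y\approx x$. If $f$ is S-continuous at each point of $\mathbb R^d$ and $f(x)$ is finite for each $x\in\mathbb R^d$, then its standard part $\operatorname{st}f$ is the unique $g\in\mathcal C$ with $f(x)\approx g(x)$ for all finite $x\in{}^*\mathbb R^d$. *)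

(* Defs.v *)
From HB Require Import structures.
From mathcomp Require Import all_boot all_order all_algebra.
From mathcomp Require Import all_classical all_reals all_analysis.
Set Implicit Arguments.
Unset Strict Implicit.
Unset Printing Implicit Defensive.
Import Order.TTheory GRing.Theory Num.Theory numFieldNormedType.Exports.
Local Open Scope classical_set_scope.
Local Open Scope ring_scope.

(* A nonstandard extension of the standard universe (the types).  Every type
   [A] has an extension [star A] (the set *A), every element [a] an extension
   [std a], every function [f : A -> B] an extension [smap f : *A -> *B] and
   every relation [P] on [A] an extension [sset P], a relation on [*A]; tuples
   are encoded by pairs, with [*(A * B)] identified to [*A * *B] by [spair].
   The laws say that extension commutes with composition of terms, pairing,
   equality, negation, conjunction and quantification, hence they give, by
   induction on formulas, the transfer principle for all many-sorted
   first-order formulas over all standard types, functions, relations and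
   constants.  Higher-order statements are covered because function types and
   powersets are themselves types: [star (A -> B)] is the set of internal
   functions from *A to *B, and quantifiers over [A -> B] transfer to
   quantifiers over internal functions.  The last law excludes the identical
   extension.  Ultrapowers by free ultrafilters on nat are instances; no
   saturation is assumed. *)
Record nonstandard_extension := NonstandardExtension {
  star :> Type -> Type;
  std : forall A, A -> star A;
  smap : forall A B, (A -> B) -> star A -> star B;
  spair : forall A B, star A -> star B -> star (A * B)%type;
  sset : forall A, set A -> set (star A);
  smap_id : forall A (x : star A), smap id x = x;
  smap_comp : forall A B C (g : B -> C) (f : A -> B) (x : star A),
    smap (g \o f) x = smap g (smap f x);
  smap_std : forall A B (f : A -> B) (a : A), smap f (std a) = std (f a);
  smap_fst : forall A B (x : star A) (y : star B), smap fst (spair x y) = x;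
  smap_snd : forall A B (x : star A) (y : star B), smap snd (spair x y) = y;
  spair_eta : forall A B (z : star (A * B)%type),
    spair (smap fst z) (smap snd z) = z;
  sset_std : forall A (P : set A) (a : A), sset P (std a) <-> P a;
  sset_preimage : forall A B (f : A -> B) (P : set B) (x : star A),
    sset (f @^-1` P) x <-> sset P (smap f x);
  sset_eq : forall A (x y : star A),
    sset [set p : A * A | p.1 = p.2] (spair x y) <-> x = y;
  sset_setC : forall A (P : set A) (x : star A), sset (~` P) x <-> ~ sset P x;
  sset_setI : forall A (P Q : set A) (x : star A),
    sset (P `&` Q) x <-> sset P x /\ sset Q x;
  sset_exists : forall A B (P : set (A * B)) (x : star A),
    sset [set a | exists b, P (a, b)] x <-> exists y, sset P (spair x y);
  star_proper : exists n : star nat, forall k : nat, n <> std k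
}.
Arguments std {n A} a.
Arguments smap {n A B} f x.
Arguments spair {n A B} x y.
Arguments sset {n A} P x.

Section nonstandard_numbers.
Variables (N : nonstandard_extension) (R : realType).

Definition smap2 A B C (f : A -> B -> C) (x : N A) (y : N B) : N C :=
  smap (fun p => f p.1 p.2) (spair x y).

(* The function *A -> *B determined by an internal function. *)
Definition sapp A B (F : N (A -> B)) (x : N A) : N B :=
  smap2 (fun f a => f a) F x.

Definition slt (x y : N R) : Prop := sset [set p | p.1 < p.2] (spair x y).
Definition sle (x y : N R) : Prop := sset [set p | p.1 <= p.2] (spair x y).

(* Used for V = R and V = R^d.  On R^d the library norm is the maximum norm,
   which gives the same finite and infinitesimal elements of *R^d as the
   Euclidean norm. *)
Variable V : normedZmodType R.

Definition snorm (x : N V) : N R := smap (fun v : V => `|v|) x.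
Definition finite_elt (x : N V) : Prop := exists r : R, sle (snorm x) (std r).
Definition infinitesimal (x : N V) : Prop :=
  forall e : R, 0 < e -> slt (snorm x) (std e).
Definition approx (x y : N V) : Prop :=
  infinitesimal (smap2 (fun u v => u - v) x y).

End nonstandard_numbers.

Section lebesgue_measure_tuple.
Variable R : realType.
Local Notation GR := (measurableTypeR R).
Local Open Scope ereal_scope.

Section cons_measure.
Variables (n : nat) (mu : {sigma_finite_measure set (n.-tuple GR) -> \bar R}).

Definition cons_pair (p : GR * n.-tuple GR) : n.+1.-tuple GR :=
  [tuple of p.1 :: p.2].

Let prod_measure : {measure set (GR * n.-tuple GR) -> \bar R} :=
  (@lebesgue_measure R \x mu).

Definition cons_measure : set (n.+1.-tuple GR) -> \bar R :=
  pushforward prod_measure cons_pair.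

Let measurable_cons_pair : measurable_fun setT cons_pair.
Proof. exact: measurable_cons. Qed.

Let mcp (A : set (n.+1.-tuple GR)) :
  measurable A -> measurable (cons_pair @^-1` A).
Proof.
by move=> mA; rewrite -[X in measurable X]setTI; exact: measurable_cons_pair.
Qed.

Let cons_measure0 : cons_measure set0 = 0.
Proof. by rewrite /cons_measure /pushforward preimage_set0 measure0. Qed.

Let cons_measure_ge0 A : 0 <= cons_measure A.
Proof. exact: measure_ge0. Qed.

Let cons_measure_sigma_additive : semi_sigma_additive cons_measure.
Proof.
move=> F mF tF mUF; rewrite /cons_measure /pushforward preimage_bigcup.
apply: measure_semi_sigma_additive.
- by move=> k; exact: mcp.
- apply/trivIsetP => /= i j _ _ ij; rewrite -preimage_setI.
  by move/trivIsetP : tF => /(_ _ _ _ _ ij) ->//; rewrite preimage_set0.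
- by rewrite -preimage_bigcup; exact: mcp.
Qed.

HB.instance Definition _ := isMeasure.Build _ _ _ cons_measure
  cons_measure0 cons_measure_ge0 cons_measure_sigma_additive.

Let cons_measure_sigma_finite : sigma_finite setT cons_measure.
Proof.
have /sigma_finiteP[F [TF ndF Foo]] := sigma_finiteT (@lebesgue_measure R).
have /sigma_finiteP[G [TG ndG Goo]] := sigma_finiteT mu.
exists (fun k => [set t | F k (thead t) /\ G k [tuple of behead t]]).
  apply/seteqP; split=> // t _.
  have [i _ Fi] : (\bigcup_i F i) (thead t) by rewrite -TF.
  have [j _ Gj] : (\bigcup_i G i) [tuple of behead t] by rewrite -TG.
  exists (maxn i j) => //; split.
    by move: Fi; exact/subsetPset/ndF/leq_maxl.
  by move: Gj; exact/subsetPset/ndG/leq_maxr.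
move=> k; have [mF Fk] := Foo k; have [mG Gk] := Goo k.
split.
  apply: measurableI.
    by rewrite -[X in measurable X]setTI; exact: (@measurable_tnth _ GR).
  by rewrite -[X in measurable X]setTI; exact: measurable_behead.
rewrite /cons_measure /pushforward /= (_ : _ @^-1` _ = F k `*` G k).
  by rewrite product_measure1E// lte_mul_pinfty// ge0_fin_numE.
have beheadK (p : GR * n.-tuple GR) : [tuple of behead (cons_pair p)] = p.2.
  exact: val_inj.
by apply/seteqP; split=> p /=; rewrite beheadK theadE.
Qed.

HB.instance Definition _ := @Measure_isSigmaFinite.Build _ _ _ cons_measure
  cons_measure_sigma_finite.

End cons_measure.

(* Lebesgue measure on R^n as the n-fold product of Lebesgue measure on R. *)
Fixpoint lebesgue_tuple n : {sigma_finite_measure set (n.-tuple GR) -> \bar R} :=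
  match n with
  | 0 => @dirac _ (0.-tuple GR) [tuple] R
  | n.+1 => cons_measure (lebesgue_tuple n)
  end.

End lebesgue_measure_tuple.

Section analysis_on_Rd.
Variables (R : realType) (d : nat).
Notation Rd := 'rV[R]_d.

Definition integral_Rd (f : Rd -> R) : R :=
  \int[lebesgue_tuple R d]_t f (\row_i tnth t i).

Definition partial (i : 'I_d) (f : Rd -> R) : Rd -> R :=
  'D_(delta_mx 0 i) f.

(* The order of the derivations is immaterial on [Cinf] below. *)
Definition multi_partial (a : 'I_d -> nat) (f : Rd -> R) : Rd -> R :=
  foldr (fun i g => iter (a i) (partial i) g) f (enum 'I_d).

Fixpoint Ck (k : nat) (f : Rd -> R) : Prop :=
  match k with
  | 0 => continuous f
  | k.+1 => continuous f /\
      forall i, (forall x, derivable f x (delta_mx 0 i)) /\ Ck k (partial i f)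
  end.

Definition Cinf : set (Rd -> R) := [set f | forall k, Ck k f].

Definition Cinfc : set (Rd -> R) :=
  [set f | Cinf f /\ compact (closure [set x | f x != 0])].

(* Multi-indices of order at most m have all entries at most m, hence the
   finite index type of the sum. *)
Definition pdo (m : nat) (c : ('I_d -> nat) -> R) (u : Rd -> R) : Rd -> R :=
  fun x => \sum_(a : {ffun 'I_d -> 'I_m.+1} | (\sum_i a i <= m)%N)
    c (fun i => a i) * multi_partial (fun i => a i) u x.

Definition convolution (f g : Rd -> R) : Rd -> R :=
  fun x => integral_Rd (fun y => f (x - y) * g y).

End analysis_on_Rd.

Section nonstandard_distributions.
Variables (N : nonstandard_extension) (R : realType) (d : nat).
Notation Rd := 'rV[R]_d.

Definition approx_Cinf (g h : N (Rd -> R)) : Prop :=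
  forall (a : 'I_d -> nat) (x : N Rd), finite_elt x ->
    approx (sapp (smap (multi_partial a) g) x)
           (sapp (smap (multi_partial a) h) x).

Definition approx_Cinfc (g h : N (Rd -> R)) : Prop :=
  approx_Cinf g h /\
  forall x : N Rd, ~ finite_elt x -> sapp g x = sapp h x.

Definition nearstandard_Cinfc (phi : N (Rd -> R)) : Prop :=
  sset (@Cinf R d) phi /\
  exists g : Rd -> R, Cinfc g /\ approx_Cinfc phi (std g).

Definition spairing (f phi : N (Rd -> R)) : N R :=
  smap2 (fun u v => integral_Rd (fun x => u x * v x)) f phi.

Definition Dprime (f : N (Rd -> R)) : Prop :=
  sset (@Cinf R d) f /\
  forall phi, nearstandard_Cinfc phi -> finite_elt (spairing f phi).

Definition delta_function (delta : N (Rd -> R)) : Prop :=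
  sset (@Cinf R d) delta /\
  forall f, nearstandard_Cinfc f ->
    approx (spairing f delta) (sapp f (std 0)).

Definition fundamental_solution (m : nat) (c : ('I_d -> nat) -> R)
    (E : N (Rd -> R)) : Prop :=
  sset (@Cinf R d) E /\ delta_function (smap (pdo m c) E).

Definition sconvolution (f g : N (Rd -> R)) : N (Rd -> R) :=
  smap2 (@convolution R d) f g.

Definition S_continuous_at (F : N Rd -> N R) (x : N Rd) : Prop :=
  forall y : N Rd, approx y x -> approx (F y) (F x).

Definition has_standard_part (F : N Rd -> N R) : Prop :=
  forall x : Rd, S_continuous_at F (std x) /\ finite_elt (F (std x)).

Definition is_standard_part (F : N Rd -> N R) : set (Rd -> R) :=
  [set g | continuous g /\
    forall x : N Rd, finite_elt x -> approx (F x) (sapp (std g) x)].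

(* Meaningful only if [has_standard_part F]. *)
Definition standard_part (F : N Rd -> N R) : Rd -> R :=
  xget (fun=> 0) (is_standard_part F).

End nonstandard_distributions.

(* Main.v *)
Require Import Defs.
From HB Require Import structures.
From mathcomp Require Import all_boot all_order all_algebra.
From mathcomp Require Import all_classical all_reals all_analysis.
From mathcomp Require Import measurable_realfun.
From mathcomp Require Import ring lra.
Import Order.TTheory GRing.Theory Num.Theory numFieldNormedType.Exports.
Set Implicit Arguments.
Unset Strict Implicit.
Unset Printing Implicit Defensive.
Local Open Scope classical_set_scope.
Local Open Scope ring_scope.

(** The internal function [E] is seen through the ultrafilter of the sets of
    standard functions [u] whose extension contains [E].  Along it, [E * f] is
    the limit of the standard functions [u * f], and the theorem becomes a
    statement about such limits.

    The one nonstandard argument is [Dprime_bounded_pairing].  If the functional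
    [phi |-> \int E phi] satisfied no continuity estimate with standard
    constants on the test functions supported in a given ball, overspill would
    give an internal test function whose derivatives of every standard order
    are infinitesimal and whose pairing with [E] is infinite; this function is
    nearstandard, which contradicts [E \in D'].  Hence the set of the [u] that
    satisfy an estimate with fixed constants belongs to the ultrafilter.

    Applied to [phi = f (x - .)], the estimate bounds [u * f] on each ball,
    uniformly in [u] ([convolution_bounded]).  The partial derivatives of
    [u * f] are the convolutions [u * d_i f], and so they obey bounds of the
    same kind.  The mean value theorem then makes [u * f] Lipschitz, and
    compares it with its first order Taylor expansion, with constants that do
    not depend on [u] ([near_lipschitz], [near_taylor1]).  These inequalities
    pass to the limit [v]: it is continuous, [d_i v] is the limit of
    [u * d_i f], and by iteration [v] is smooth.  Equicontinuity makes the
    convergence uniform on balls, and this says that [E * f] is infinitely close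
    to [v] at every finite point ([limit_uniform]).

    Finally [P v] is the limit of [u * P f], that is of [P u * f], whose value
    at [x] is [\int f (x - y) (P u) (y) dy] ([convolution_pdo]); the limit is
    [f x] because [P E] is a delta function.  The passage of derivatives from
    one factor to the other is differentiation under the integral sign, once for
    each of the two ways to write a convolution; these agree because Lebesgue
    measure is invariant under [y |-> x - y]. *)

(** * Lebesgue measure on tuples *)

Section rV_norm.
Variables (R : realType) (d : nat).
Implicit Types x : 'rV[R]_d.

Lemma rV_norm_leP x (r : R) :
  reflect (0 <= r /\ forall i, `|x ord0 i| <= r) (`|x| <= r).
Proof.
rewrite [`|x|]/Num.Def.normr /= mx_normrE.
apply: (iffP idP) => [/bigmax_leP[r0 xr]|[r0 xr]].
  by split=> // i; exact: (xr (ord0, i)).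
by apply/bigmax_leP; split=> // -[j i] _; rewrite /= (ord1 j).
Qed.

Lemma rV_norm_coord x i : `|x ord0 i| <= `|x|.
Proof. by have /rV_norm_leP[_ ->] := lexx `|x|. Qed.

End rV_norm.

Section tuple_row.
Variables (R : realType) (d : nat).
Local Notation GR := (measurableTypeR R).

Definition row_tuple (t : d.-tuple GR) : 'rV[R]_d := \row_i tnth t i.

Definition box (r : R) : set (d.-tuple GR) := [set t | `|row_tuple t| <= r].

Lemma measurable_box_at (q : 'rV[R]_d) (r : R) :
  measurable [set t : d.-tuple GR | forall i, `|tnth t i - q ord0 i| <= r].
Proof.
rewrite (_ : [set t | _] = \bigcap_(i in [set` enum 'I_d])
    (@tnth d GR ^~ i @^-1` `[q ord0 i - r, q ord0 i + r])); last first.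
  apply/seteqP; split=> t /= h i; last first.
    by have := h i (mem_enum _ i); rewrite /= in_itv/= ler_distl.
  by move=> _ /=; rewrite in_itv/= -ler_distl.
rewrite bigcap_seq; apply: bigsetI_measurable => i _.
by rewrite -[X in measurable X]setTI; apply: (@measurable_tnth _ GR).
Qed.

(** The product sigma-algebra on tuples contains the open sets because an open
    set is a countable union of rational cubes. *)
Lemma measurable_open_row (U : set 'rV[R]_d) :
  open U -> measurable (row_tuple @^-1` U).
Proof.
move=> oU.
pose cube (p : 'rV[rat]_d * nat) := [set t : d.-tuple GR |
  forall i, `|tnth t i - (map_mx ratr p.1 : 'rV[R]_d) ord0 i| <= p.2.+1%:R^-1].
pose inU := [set p | cube p `<=` row_tuple @^-1` U].
rewrite (_ : _ @^-1` _ = \bigcup_p (if `[< inU p >] then cube p else set0)).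
  apply: countable_bigcupT_measurable; first exact: countableP.
  by move=> p; case: ifP => _ //; exact: measurable_box_at.
apply/seteqP; split=> [t /= Ut|t [p _]]; last first.
  by case: ifPn => // /asboolP; exact.
have /nbhs_ballP[e /= e0 eU] : nbhs (row_tuple t) U by exact: open_nbhs_nbhs.
have [k] : exists k : nat, k.+1%:R^-1 < e / 2.
  have := near_infty_natSinv_lt (PosNum (divr_gt0 e0 (ltr0n _ 2))).
  by case=> k _ /(_ k (leqnn k)); exists k.
move=> ke.
have qE i : exists q : rat, `|tnth t i - ratr q| <= k.+1%:R^-1 :> R.
  have /rat_in_itvoo[q] : tnth t i < tnth t i + k.+1%:R^-1.
    by rewrite ltrDl invr_gt0 ltr0n.
  rewrite inE/= => /andP[]; rewrite !bnd_simp => tq qt; exists q.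
  by rewrite distrC ger0_norm ?subr_ge0 ?ltW// ltrBlDl.
have [q qP] := choice qE.
have cubeU : inU (\row_i q i, k).
  move=> s /= sq; apply: eU; rewrite -ball_normE /ball_/=.
  have /le_lt_trans : `|row_tuple t - row_tuple s| <= k.+1%:R^-1 + k.+1%:R^-1.
    apply/rV_norm_leP; split=> [|i]; first by rewrite addr_ge0// invr_ge0.
    rewrite !mxE -(subrKA (ratr (q i))) (le_trans (ler_normD _ _))// lerD//.
    by have := sq i; rewrite !mxE distrC.
  by apply; rewrite (splitr e) ltrD.
exists (\row_i q i, k) => //; case: ifPn => [_ i|/asboolPn//].
by rewrite !mxE.
Qed.

Lemma continuous_measurable_row (g : 'rV[R]_d -> R) :
  continuous g -> measurable_fun setT (g \o row_tuple).
Proof.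
move=> cg; apply: (measurability _ (RGenOpens.measurableE R)).
move=> /= _ [_ [a [b ->]] <-]; rewrite setTI comp_preimage.
apply: measurable_open_row; move/continuousP : cg; apply.
exact: interval_open.
Qed.

Lemma measurable_box r : measurable (box r).
Proof.
have := continuous_measurable_row (@norm_continuous R 'rV[R]_d).
move=> /(_ measurableT _ (measurable_itv `]-oo, r])).
by rewrite setTI (_ : _ @^-1` _ = box r).
Qed.

End tuple_row.

Section lebesgue_tuple.
Variable R : realType.
Local Notation GR := (measurableTypeR R).

Lemma lebesgue_box d (r : R) : (lebesgue_tuple R d (box r) < +oo)%E.
Proof.
elim: d => [|d IH] /=; first by rewrite diracE ltry.
have mI : measurable (`[- r, r]%classic : set GR) by exact: measurable_itv.
rewrite /cons_measure /pushforward.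
apply: (@le_lt_trans _ _
  ((lebesgue_measure \x lebesgue_tuple R d)%E (`[-r, r] `*` box r))).
  apply: le_measure; rewrite ?inE.
  - rewrite -[X in measurable X]setTI.
    apply: (measurable_cons measurable_fst measurable_snd) => //.
    exact: measurable_box.
  - by apply: measurableX => //; exact: measurable_box.
  - move=> [x t] /= /rV_norm_leP[r0 h]; split=> /=.
      by have := h ord0; rewrite mxE tnth0 in_itv/= ler_norml.
    apply/rV_norm_leP; split=> // i.
    by have := h (lift ord0 i); rewrite !mxE tnthS.
rewrite product_measure1E//; last exact: measurable_box.
rewrite lte_mul_pinfty//.
by rewrite /= lebesgue_measure_itv/=; case: ifP.
Qed.

Definition reflect_tuple d (a : 'I_d -> R) (t : d.-tuple GR) : d.-tuple GR :=
  [tuple a i - tnth t i | i < d].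

Lemma measurable_reflect_tuple d (a : 'I_d -> R) :
  measurable_fun setT (reflect_tuple a).
Proof.
apply/measurable_fun_tnthP => i.
rewrite (_ : _ \o _ = fun t => a i - tnth t i).
  by apply: measurable_funB => //; exact: measurable_tnth.
by apply/funext => t /=; rewrite tnth_mktuple.
Qed.

Lemma lebesgue_measure_reflect (a : R) (A : set GR) : measurable A ->
  lebesgue_measure ((fun x : GR => a - x : GR) @^-1` A) = lebesgue_measure A.
Proof.
move=> mA; apply/esym.
have mf : measurable_fun [set: GR] (fun x : GR => a - x : GR).
  exact: measurable_funB.
pose f : {mfun GR >-> GR} := HB.pack (fun x : GR => a - x : GR)
  (isMeasurableFun.Build _ _ _ _ _ mf).
apply: (lebesgue_measure_unique (mu := pushforward lebesgue_measure f)) => //.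
move=> _ [[b c]] _ <-; rewrite /= /pushforward.
rewrite [X in _ = _ X](_ : _ = `[a - c, a - b[%classic).
  rewrite !lebesgue_measure_itv/= !lte_fin ltrD2l ltrN2.
  by congr (if _ then _ else _); rewrite -!EFinB; congr EFin; ring.
by apply/seteqP; split=> x /=; rewrite !in_itv/=; lra.
Qed.

(** A product measure is determined by its values on rectangles, so that the
    invariance follows by induction from that of the line.  It is the change of
    variables behind the commutativity of convolution. *)
Lemma lebesgue_tuple_reflect d (a : 'I_d -> R) (A : set (d.-tuple GR)) :
  measurable A ->
  lebesgue_tuple R d (reflect_tuple a @^-1` A) = lebesgue_tuple R d A.
Proof.
elim: d a A => [|d IH] a A mA.
  congr (lebesgue_tuple R 0 _); apply/seteqP.
  by split => t /=; rewrite [t]tuple0 [reflect_tuple _ _]tuple0.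
rewrite /= /cons_measure /pushforward.
pose F (p : GR * d.-tuple GR) : GR * d.-tuple GR :=
  (a ord0 - p.1, reflect_tuple (fun i => a (lift ord0 i)) p.2).
have mF : measurable_fun setT F.
  apply: measurable_fun_pair; first exact: measurable_funB.
  by apply: measurableT_comp => //; exact: measurable_reflect_tuple.
pose f : {mfun (GR * d.-tuple GR)%type >-> (GR * d.-tuple GR)%type} :=
  HB.pack F (isMeasurableFun.Build _ _ _ _ _ mF).
have reflect_cons : reflect_tuple a \o @cons_pair R d = @cons_pair R d \o F.
  apply/funext => -[x t]; apply: eq_from_tnth => i; rewrite tnth_mktuple.
  by case: (unliftP ord0 i) => [j|] ->; rewrite ?tnth0// !tnthS tnth_mktuple.
rewrite -[_ @^-1` (_ @^-1` A)]/((reflect_tuple a \o @cons_pair R d) @^-1` A).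
rewrite reflect_cons.
apply/esym; apply: (product_measure_unique (m' := pushforward _ f)) => /=;
  last first.
  rewrite -[X in measurable X]setTI.
  exact: (measurable_cons measurable_fst measurable_snd).
move=> B C mB mC; rewrite /pushforward.
rewrite (_ : F @^-1` _ = ((fun x : GR => a ord0 - x : GR) @^-1` B) `*`
  (reflect_tuple (fun i => a (lift ord0 i)) @^-1` C))//.
have mB' : measurable ((fun x : GR => a ord0 - x : GR) @^-1` B).
  by rewrite -[X in measurable X]setTI; exact: measurable_funB.
have mC' : measurable (reflect_tuple (fun i => a (lift ord0 i)) @^-1` C).
  by rewrite -[X in measurable X]setTI; exact: measurable_reflect_tuple.
rewrite product_measure1E//; congr (_ * _)%E; last exact: IH.
exact: lebesgue_measure_reflect.
Qed.

End lebesgue_tuple.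

(** * Integrals of continuous functions *)

Section integral_of_continuous.
Variables (R : realType) (d : nat).
Notation Rd := 'rV[R]_d.
Implicit Types (g h u f : Rd -> R) (r : R) (x y : Rd).

Definition vanishes_off r g := forall y, r < `|y| -> g y = 0.

Definition Cc g := continuous g /\ exists r, vanishes_off r g.

Lemma closed_norm_le r : closed [set x : Rd | `|x| <= r].
Proof.
rewrite (_ : mkset _ = Num.norm @^-1` [set s : R | s <= r])//.
by apply: (continuous_closedP _).1; [exact: norm_continuous | exact: closed_le].
Qed.

Lemma compact_norm_le r : compact [set x : Rd | `|x| <= r].
Proof.
apply: bounded_closed_compact; last exact: closed_norm_le.
exists r; split=> [|s rs x /= xr]; first exact: num_real.
by rewrite (le_trans xr)// ltW.
Qed.

Lemma continuous_bounded_on_ball g r : continuous g ->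
  exists2 M, 0 <= M & forall x, `|x| <= r -> `|g x| <= M.
Proof.
move=> cg.
have /compact_bounded[M [_ gM]] :
    compact (g @` [set x : Rd | `|x| <= r]).
  apply: continuous_compact; last exact: compact_norm_le.
  exact: continuous_subspaceT.
exists (`|M| + 1); first by rewrite addr_ge0.
by move=> x xr; apply: gM; [rewrite ltr_pwDr// ler_norm | exists x].
Qed.

Lemma Cc_bounded g : Cc g -> exists2 M, 0 <= M & forall x, `|g x| <= M.
Proof.
move=> [cg [r gr]]; have [M M0 gM] := continuous_bounded_on_ball r cg.
by exists M => // x; have [/gM//|/gr ->] := leP `|x| r; rewrite normr0.
Qed.

Lemma continuous_reflect g x : continuous g -> continuous (fun y => g (x - y)).
Proof.
move=> cg y; apply: (@continuous_comp _ _ _ (fun y => x - y) g); last exact: cg.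
by apply: continuousB; [exact: cst_continuous | exact: cvg_id].
Qed.

Lemma vanishes_off_reflect g r x :
  vanishes_off r g -> vanishes_off (r + `|x|) (fun y => g (x - y)).
Proof.
move=> gr y ry; apply: gr.
by have := lerB_dist y x; rewrite (distrC y); move: ry; lra.
Qed.

Lemma Cc_reflect g x : Cc g -> Cc (fun y => g (x - y)).
Proof.
move=> [cg [r gr]]; split; first exact: continuous_reflect.
by exists (r + `|x|); exact: vanishes_off_reflect.
Qed.

Lemma CcMr g h : continuous g -> Cc h -> Cc (fun y => g y * h y).
Proof.
move=> cg [ch [r hr]]; split.
  by move=> y; apply: continuousM; [exact: cg | exact: ch].
by exists r => y /hr ->; rewrite mulr0.
Qed.

Lemma Cc_integrable g :
  Cc g -> (lebesgue_tuple R d).-integrable setT (EFin \o (g \o @row_tuple R d)).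
Proof.
move=> [cg [r gr]]; have [M M0 gM] := continuous_bounded_on_ball r cg.
have mB := @measurable_box R d r.
have mg := continuous_measurable_row cg.
have : (lebesgue_tuple R d).-integrable (box r) (EFin \o (g \o @row_tuple R d)).
  apply: measurable_bounded_integrable => //; first exact: lebesgue_box.
    exact: measurable_funTS.
  exists M; split=> [|s Ms t /= /gM]; first exact: num_real.
  by move=> /le_trans; apply; exact: ltW.
move=> /(integrable_mkcond _ mB); apply: eq_integrable => // t _.
rewrite /patch; case: ifPn => // tr; rewrite /= gr// ltNge.
by apply: contra tr => tr; rewrite inE.
Qed.

Lemma integral_RdZ g k : Cc g ->
  integral_Rd (fun y => k * g y) = k * integral_Rd g.
Proof. by move=> /Cc_integrable ig; rewrite /integral_Rd RintegralZl. Qed.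

Lemma integral_Rd_sum (I : Type) (s : seq I) (P : pred I) (G : I -> Rd -> R) :
  (forall i, Cc (G i)) ->
  integral_Rd (fun y => \sum_(i <- s | P i) G i y) =
  \sum_(i <- s | P i) integral_Rd (G i).
Proof.
move=> cG; rewrite /integral_Rd /Rintegral.
under eq_integral do rewrite -sumEFin.
rewrite integral_sum//; last by move=> i; exact: Cc_integrable (cG i).
rewrite -EFin_sum_fine// => i _; apply: integrable_fin_num => //.
exact: Cc_integrable (cG i).
Qed.

Lemma integral_Rd_reflect g x : Cc g ->
  integral_Rd (fun y => g (x - y)) = integral_Rd g.
Proof.
move=> cg; rewrite /integral_Rd /Rintegral; congr fine.
pose F := @reflect_tuple R d (x ord0).
have row_reflect t : x - row_tuple t = row_tuple (F t).
  by apply/rowP => i; rewrite !mxE tnth_mktuple.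
have mF : measurable_fun setT F by exact: measurable_reflect_tuple.
transitivity
  (\int[lebesgue_tuple R d]_t ((EFin \o (g \o @row_tuple R d)) \o F) t)%E.
  by apply: eq_integral => t _; rewrite /= -row_reflect.
have mg : measurable_fun setT (EFin \o (g \o @row_tuple R d)).
  by apply/measurable_EFinP; exact: continuous_measurable_row cg.1.
have ig : (lebesgue_tuple R d).-integrable (F @^-1` setT)
    ((EFin \o (g \o @row_tuple R d)) \o F).
  rewrite preimage_setT; have := Cc_integrable (Cc_reflect x cg).
  by apply: eq_integrable => // t _; rewrite /= row_reflect.
have := integral_pushforward mF mg ig measurableT.
rewrite preimage_setT => <-.
by apply: eq_measure_integral => A mA _; exact: lebesgue_tuple_reflect.
Qed.

Lemma convolutionC u f : continuous u -> Cc f ->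
  convolution u f = convolution f u.
Proof.
move=> cu cf; apply/funext => x; rewrite /convolution.
rewrite -[RHS](@integral_Rd_reflect _ x).
  by congr integral_Rd; apply/funext => y; rewrite mulrC subKr.
by under eq_fun do rewrite mulrC; apply: CcMr => //; exact: Cc_reflect.
Qed.

End integral_of_continuous.

(** * Differentiation of a convolution *)

Section derivative_of_convolution.
Variables (R : realType) (d : nat).
Notation Rd := 'rV[R]_d.
Implicit Types (a b u f : Rd -> R) (r : R) (x y z : Rd).

Lemma is_derive_line a v z (t : R) : derivable a (t *: v + z) v ->
  is_derive t 1 (fun s : R => a (s *: v + z)) ('D_v a (t *: v + z)).
Proof.
move=> da.
have E : (fun h : R =>
    h^-1 *: (((fun s => a (s *: v + z)) \o shift t) (h *: 1) -
    a (t *: v + z))) = (fun h => h^-1 *: ((a \o shift (t *: v + z)) (h *: v) -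
    a (t *: v + z))).
  by apply/funext => h /=; rewrite [h *: 1]mulr1 scalerDl addrA.
by apply: DeriveDef; rewrite /derivable /derive E.
Qed.

Lemma norm_delta_le1 (i : 'I_d) : `|delta_mx 0 i : Rd| <= 1.
Proof.
apply/rV_norm_leP; split=> // j; rewrite mxE.
by case: (_ && _); rewrite /= ?normr1 ?normr0.
Qed.

(** Differentiation under the integral sign.  The last hypothesis makes the
    domain of integration bounded, uniformly for small [t]; it covers both the
    case where [a] and the case where [b] has compact support. *)
Lemma is_derive_convolution (i : 'I_d) a b x r :
  (forall y, derivable a y (delta_mx 0 i)) -> continuous a ->
  continuous (partial i a) -> continuous b ->
  (forall (t : R) y, `|t| < 1 -> r < `|y| ->
     a (t *: delta_mx 0 i + x - y) * b y = 0 /\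
     partial i a (t *: delta_mx 0 i + x - y) * b y = 0) ->
  is_derive x (delta_mx 0 i) (convolution a b) (convolution (partial i a) b x).
Proof.
move=> da ca cda cb off; set e := delta_mx 0 i.
pose F (t : R) (s : d.-tuple (measurableTypeR R)) :=
  a (t *: e + x - row_tuple s) * b (row_tuple s).
have itvP (t : R) : `]-1, 1[%classic t -> `|t| < 1.
  by rewrite /= in_itv/= ltr_norml.
have dF (t : R) s : is_derive t 1 (F ^~ s)
    (partial i a (t *: e + x - row_tuple s) * b (row_tuple s)).
  have dl := @is_derive_line a e (x - row_tuple s) t (da _).
  have := is_deriveM dl (is_derive_cst (b (row_tuple s)) t 1).
  rewrite scaler0 add0r => dFs.
  rewrite (_ : F ^~ s = (fun t => a (t *: e + (x - row_tuple s))) *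
    cst (b (row_tuple s))); last by apply/funext => t'; rewrite !fctE /F addrA.
  by apply: is_derive_eq; rewrite [RHS]mulrC -addrA.
have d1F (t : R) s : partial1of2 F t s =
    partial i a (t *: e + x - row_tuple s) * b (row_tuple s).
  by rewrite partial1of2E; exact: derive_val.
have CcF (g : Rd -> R) (t : R) : continuous g ->
    (forall y, r < `|y| -> g (t *: e + x - y) * b y = 0) ->
    Cc (fun y => g (t *: e + x - y) * b y).
  move=> cg off'; split; last by exists r => y /off'.
  by move=> y; apply: continuousM; [exact: continuous_reflect | exact: cb].
(* The dominating function is constant on the cube: there the argument of [a]
   has norm at most [1 + `|x| + r]. *)
have [Ma Ma0 aM] := continuous_bounded_on_ball (1 + `|x| + r) cda.
have [Mb Mb0 bM] := continuous_bounded_on_ball r cb.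
pose G (s : d.-tuple (measurableTypeR R)) := Ma * Mb * \1_(box r) s.
have mB := @measurable_box R d r.
have I0 : (`]-1, 1[%classic : set R) 0 by rewrite /= in_itv/=; lra.
have := @cvg_differentiation_under_integral R _ _ (lebesgue_tuple R d) F setT
  measurableT 0 (-1) 1 I0 _ _ G.
have intE (g : Rd -> R) (t : R) : convolution g b (t *: e + x) =
    (\int[lebesgue_tuple R d]_s
      (g (t *: e + x - row_tuple s) * b (row_tuple s)))%R by [].
have -> : (\int[lebesgue_tuple R d]_s partial1of2 F 0 s)%R =
    convolution (partial i a) b x.
  rewrite -[x in RHS]add0r -(scale0r e) intE.
  by apply: eq_Rintegral => s _; rewrite d1F.
have -> : (fun h : R => h^-1 *: ((\int[lebesgue_tuple R d]_s F (h + 0) s)%R -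
    (\int[lebesgue_tuple R d]_s F 0 s)%R)) =
    (fun h : R => h^-1 *: ((convolution a b \o shift x) (h *: e) -
      convolution a b x)).
  apply/funext => h; rewrite addr0 /F -!intE.
  by rewrite [0 *: e + x](_ : _ = x)// scale0r add0r.
move=> cvgI; suff cvgc : (h : R)^-1 *: ((convolution a b \o shift x) (h *: e) -
    convolution a b x) @[h --> 0^'] --> convolution (partial i a) b x.
  by apply: DeriveDef; [apply/cvg_ex; eexists; exact: cvgc | exact: cvg_lim].
apply: cvgI.
- move=> t /itvP t1; apply: Cc_integrable (CcF _ _ _ _) => // y ry.
  by have [] := off _ _ t1 ry.
- by move=> t s _ _; exact: ex_derive.
- by move=> s; rewrite /G mulr_ge0// ?mulr_ge0// indicE.
- have : (lebesgue_tuple R d).-integrable (box r) (EFin \o cst (Ma * Mb)).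
    apply: measurable_bounded_integrable => //; first exact: lebesgue_box.
    exists (Ma * Mb); split=> [|M' MM s _ /=]; first exact: num_real.
    by rewrite ger0_norm ?mulr_ge0// ltW.
  move=> /(integrable_mkcond _ mB); apply: eq_integrable => // s _.
  by rewrite /patch /G /= indicE; case: ifP => _; rewrite /= ?mulr1 ?mulr0.
- move=> t s /itvP t1 _; rewrite d1F /G indicE.
  have [sr|sr] := leP `|row_tuple s| r; last first.
    by have [_ ->] := off _ _ t1 sr; rewrite normr0 !mulr_ge0.
  rewrite mem_set// mulr1 normrM ler_pM// ?bM// aM//.
  rewrite (le_trans (ler_normB _ _))// lerD//.
  rewrite (le_trans (ler_normD _ _))// lerD2r.
  by rewrite normrZ mulr_ile1 ?(ltW t1) ?norm_delta_le1 ?normr_ge0.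
Qed.


End derivative_of_convolution.

(** * Smooth functions and their convolutions *)

Section smooth_functions.
Variables (R : realType) (d : nat).
Notation Rd := 'rV[R]_d.
Notation e_ i := (delta_mx 0 i : Rd).
Implicit Types (f g h u : Rd -> R) (r : R) (x y z : Rd) (i : 'I_d)
  (a : 'I_d -> nat).

Lemma Cinf_continuous f : Cinf f -> continuous f.
Proof. by move/(_ 0%N). Qed.

Lemma Cinf_derivable f i x : Cinf f -> derivable f x (e_ i).
Proof. by move/(_ 1%N) => [_ /(_ i)[]]. Qed.

Lemma Cinf_partial f i : Cinf f -> Cinf (partial i f).
Proof. by move=> Cf k; have [_ /(_ i)[]] := Cf k.+1. Qed.

(** [Ck] is defined by recursion on the order, so that a class of functions that
    is stable under partial differentiation consists of smooth functions. *)
Lemma Cinf_coind (S : set (Rd -> R)) :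
  (forall g, S g -> continuous g /\
    forall i, (forall x, derivable g x (e_ i)) /\ S (partial i g)) ->
  S `<=` @Cinf R d.
Proof.
move=> coS f Sf k; elim: k f Sf => [|k IH] f /coS[cf df] //=.
by split=> // i; have [? /IH] := df i.
Qed.

Lemma vanishes_off_partial f r i :
  vanishes_off r f -> vanishes_off r (partial i f).
Proof.
move=> fr x rx; rewrite /partial (@near_eq_derive _ _ _ f (cst 0)).
  exact: derive_cst.
have : \forall y \near x, r < `|y|.
  by have /(_ _ (lt_nbhsr rx)) := @norm_continuous R Rd x.
by apply: filterS => y /fr.
Qed.

Lemma Cinfc_vanishes f : Cinfc f -> exists r, vanishes_off r f.
Proof.
move=> [_ /compact_bounded[M [_ fM]]]; exists (M + 1) => x Mx.
apply: contrapT => /eqP fx0; have : `|x| <= M + 1.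
  by apply: (fM (M + 1)); [rewrite ltrDl | exact: subset_closure].
by rewrite leNgt Mx.
Qed.

Lemma CinfcI f r : Cinf f -> vanishes_off r f -> Cinfc f.
Proof.
move=> Cf fr; split=> //.
apply: (subclosed_compact _ (@compact_norm_le R d r)).
  exact: closed_closure.
rewrite closureE => x; apply; split; first exact: closed_norm_le.
by move=> y /= fy0; rewrite leNgt; apply: contra fy0 => /fr ->.
Qed.

Lemma Cinfc_Cc f : Cinfc f -> Cc f.
Proof.
move=> cf; split; last exact: Cinfc_vanishes.
by apply: Cinf_continuous; case: cf.
Qed.

Lemma Cinfc_partial f i : Cinfc f -> Cinfc (partial i f).
Proof.
move=> cf; have [r fr] := Cinfc_vanishes cf; have [Cf _] := cf.
exact: CinfcI (Cinf_partial i Cf) (vanishes_off_partial i fr).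
Qed.

(** The workhorse for iterated derivatives: whatever passes to first partial
    derivatives passes to all partial derivatives, taken in the same order on
    both sides. *)
Lemma multi_partial_rel (Q : (Rd -> R) -> (Rd -> R) -> Prop) a f g :
  (forall i g h, Q g h -> Q (partial i g) (partial i h)) ->
  Q f g -> Q (multi_partial a f) (multi_partial a g).
Proof.
move=> QS Qfg; rewrite /multi_partial; elim: (enum 'I_d) => //= i s IH.
by elim: (a i) => //= k; exact: QS.
Qed.

Lemma multi_partial_ind (Q : set (Rd -> R)) a f :
  (forall i g, Q g -> Q (partial i g)) -> Q f -> Q (multi_partial a f).
Proof.
move=> QS Qf.
by apply: (@multi_partial_rel (fun g _ => Q g) a f f) => // i g _ /QS.
Qed.

(** Converse of [is_derive_line]; it reduces directional derivatives to the
    calculus of one variable. *)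
Lemma is_derive_along_line f v y (df : R) :
  is_derive (0 : R) 1 (fun t : R => f (t *: v + y)) df -> is_derive y v f df.
Proof.
have E : (fun h : R =>
    h^-1 *: (((fun t => f (t *: v + y)) \o shift 0) (h *: 1) -
    f (0 *: v + y))) = (fun h : R => h^-1 *: ((f \o shift y) (h *: v) - f y)).
  by apply/funext => h /=; rewrite [h *: 1]mulr1 addr0 scale0r add0r.
by case; rewrite /derivable /derive E; exact: DeriveDef.
Qed.

Lemma is_derive_reflect f (k : R) x y i : derivable f (x - y) (e_ i) ->
  is_derive y (e_ i) (fun z => k * f (x - z)) (- k * partial i f (x - y)).
Proof.
move=> df; apply: is_derive_along_line.
pose L (t : R) := f (t *: e_ i + (x - y)).
have dL : is_derive (- 0 : R) 1 L (partial i f (x - y)).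
  rewrite oppr0 /partial -[X in 'D_(e_ i) f X]add0r -(scale0r (e_ i)).
  by apply: is_derive_line; rewrite scale0r add0r.
have dN : is_derive (0 : R) 1 (-%R : R -> R) (- 1) by exact: is_deriveNid.
have dLN := is_deriveZ k (is_derive1_comp dL dN).
rewrite (_ : (fun t : R => _) = k \*: (L \o -%R)).
  by apply: is_derive_eq; rewrite mulrN1 scalerN mulNr.
by apply/funext => t; rewrite /L /= scaleNr opprD addrA addrAC addrC.
Qed.

Lemma Cinf_reflect f (k : R) x : Cinf f -> Cinf (fun y => k * f (x - y)).
Proof.
move=> Cf; apply: (@Cinf_coind [set g | exists2 h, Cinf h &
  exists k, g = fun y => k * h (x - y)]); last by exists f => //; exists k.
move=> _ [h Ch [{}k ->]]; split.
  move=> y; apply: continuousM; first exact: cst_continuous.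
  by apply: continuous_reflect; exact: Cinf_continuous.
move=> i; have D y := is_derive_reflect k (@Cinf_derivable h i (x - y) Ch).
split=> [y|]; first exact: ex_derive.
exists (partial i h); first exact: Cinf_partial.
by exists (- k); apply/funext => y; exact: derive_val.
Qed.

(** The reflection produces signs, to which the bounds on derivatives are
    blind: only the absolute value of the constant is tracked. *)
Lemma multi_partial_reflect f (k : R) x a : Cinf f ->
  exists2 k', `|k'| = `|k| & multi_partial a (fun y => k * f (x - y)) =
    (fun y => k' * multi_partial a f (x - y)).
Proof.
move=> Cf; pose Q g h := Cinf h /\ exists2 k', `|k'| = `|k| &
  g = (fun y => k' * h (x - y)).
suff [] : Q (multi_partial a (fun y => k * f (x - y))) (multi_partial a f).
  by [].
apply: multi_partial_rel => [i g h [Ch [k' k'k ->]]|]; last first.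
  by split=> //; exists k.
split; first exact: Cinf_partial.
exists (- k'); first by rewrite normrN.
apply/funext => y.
have D := is_derive_reflect k' (@Cinf_derivable h i (x - y) Ch).
exact: derive_val.
Qed.

(** Finitely many multi-indices have all their entries at most [n]. *)
Lemma multi_partials_bounded f (n : nat) : Cinfc f ->
  exists2 M, 0 < M & forall a, (forall i, a i <= n)%N ->
    forall x, `|multi_partial a f x| <= M.
Proof.
move=> cf.
have bnd (b : {ffun 'I_d -> 'I_n.+1}) : exists M, forall x,
    `|multi_partial (fun i => b i) f x| <= M.
  have cbf := multi_partial_ind (fun i => b i : nat)
    (fun i g => @Cinfc_partial g i) cf.
  by have [M _ fM] := Cc_bounded (Cinfc_Cc cbf); exists M.
have [M fM] := choice bnd.
exists (1 + \sum_b `|M b|); first by rewrite ltr_pwDl// sumr_ge0.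
move=> a an x; pose b : {ffun 'I_d -> 'I_n.+1} := [ffun i => inord (a i)].
have -> : a = (fun i => b i : nat).
  by apply/funext => i; rewrite ffunE inordK// ltnS.
rewrite (le_trans (fM b x))// (le_trans (ler_norm _))//.
by rewrite (bigD1 b)//= addrCA ler_wpDr// addr_ge0// sumr_ge0.
Qed.

Lemma is_derive_convolutionr u f i x : continuous u -> Cinfc f ->
  is_derive x (e_ i) (convolution u f) (convolution u (partial i f) x).
Proof.
move=> cu cf; have [r fr] := Cinfc_vanishes cf.
rewrite (convolutionC cu (Cinfc_Cc cf)).
rewrite (convolutionC cu (Cinfc_Cc (Cinfc_partial i cf))).
have [Cf _] := cf.
apply: (@is_derive_convolution _ _ i f u x (r + `|x| + 1)) => //.
- by move=> y; exact: Cinf_derivable.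
- exact: Cinf_continuous.
- exact/Cinf_continuous/Cinf_partial.
move=> t y t1 ry.
have rd : r < `|t *: e_ i + x - y|.
  have := lerB_dist y (t *: e_ i + x); rewrite (distrC y).
  have := ler_normD (t *: e_ i) x; rewrite normrZ.
  have : `|t| * `|e_ i| <= 1 by rewrite mulr_ile1 ?norm_delta_le1 ?(ltW t1).
  by move: ry; lra.
by rewrite fr// (vanishes_off_partial i fr)// !mul0r.
Qed.

Lemma is_derive_convolutionl u f i x : Cinf u -> Cc f ->
  is_derive x (e_ i) (convolution u f) (convolution (partial i u) f x).
Proof.
move=> Cu [cf [r fr]]; apply: (@is_derive_convolution _ _ i u f x r) => //.
- by move=> y; exact: Cinf_derivable.
- exact: Cinf_continuous.
- exact/Cinf_continuous/Cinf_partial.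
- by move=> t y _ /fr ->; rewrite !mulr0.
Qed.

(** Both sides are the iterated derivative of the convolution itself, computed
    in the same order. *)
Lemma multi_partial_convolution u f a : Cinf u -> Cinfc f ->
  convolution u (multi_partial a f) = convolution (multi_partial a u) f.
Proof.
move=> Cu cf; transitivity (multi_partial a (convolution u f)).
  pose Q g h := Cinfc g /\ convolution u g = h.
  suff [] : Q (multi_partial a f) (multi_partial a (convolution u f)) by [].
  apply: multi_partial_rel => // i g _ [cg <-].
  split; first exact: Cinfc_partial.
  apply/funext => x; apply/esym.
  have := is_derive_convolutionr i x (Cinf_continuous Cu) cg.
  by move=> D; exact: derive_val.
pose Q g h := Cinf h /\ g = convolution h f.
suff [] : Q (multi_partial a (convolution u f)) (multi_partial a u) by [].
apply: multi_partial_rel => // i _ h [Ch ->]; split; first exact: Cinf_partial.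
apply/funext => x; have := is_derive_convolutionl i x Ch (Cinfc_Cc cf).
by move=> D; exact: derive_val.
Qed.

End smooth_functions.

(** * Mean value estimates *)

Section mean_value.
Variables (R : realType) (d : nat).
Notation Rd := 'rV[R]_d.
Notation e_ i := (delta_mx 0 i : Rd).
Implicit Types (g : Rd -> R) (x y z : Rd) (i : 'I_d) (C r t : R).

Lemma mean_value_le (F dF : R -> R) C t :
  (forall s : R, is_derive s 1 F (dF s)) ->
  (forall s : R, `|s| <= `|t| -> `|dF s| <= C) -> `|F t - F 0| <= C * `|t|.
Proof.
move=> DF dFC.
have cF a b : {within `[a, b], continuous F}.
  apply: derivable_within_continuous => s _; exact: ex_derive.
have [t0|t0] := leP 0 t.
  have [c ct ->] := MVT_segment t0 (fun s _ => DF s) (cF 0 t).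
  rewrite subr0 normrM ler_wpM2r// dFC//.
  by move: ct; rewrite in_itv/= => /andP[? ?]; rewrite !ger0_norm.
have [c ct E] := MVT_segment (ltW t0) (fun s _ => DF s) (cF t 0).
rewrite distrC E sub0r normrM normrN ler_wpM2r// dFC//.
move: ct; rewrite in_itv/= => /andP[? ?].
by rewrite !ler0_norm ?lerN2// ltW.
Qed.

Lemma line_le g C i x t : (forall y, derivable g y (e_ i)) ->
  (forall y, `|y| <= `|x| + `|t| -> `|partial i g y| <= C) ->
  `|g (t *: e_ i + x) - g x| <= C * `|t|.
Proof.
move=> dg gC; pose F (s : R) := g (s *: e_ i + x).
have := @mean_value_le F (fun s => partial i g (s *: e_ i + x)) C t.
rewrite /F scale0r add0r; apply=> [s|s st]; first exact: is_derive_line.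
apply: gC; rewrite (le_trans (ler_normD _ _))// addrC lerD2l normrZ.
by rewrite -[leRHS]mulr1 ler_pM// norm_delta_le1.
Qed.

(** From [y] to [x] one coordinate moves at a time.  The intermediate points
    stay in the ball of radius [r] of the maximum norm, and the factor 3 leaves
    room for the steps, whose length is at most [2 * r]. *)
Lemma lipschitz_of_partials g C r x y :
  (forall i z, derivable g z (e_ i)) ->
  (forall i z, `|z| <= 3 * r -> `|partial i g z| <= C) ->
  `|x| <= r -> `|y| <= r -> `|g x - g y| <= d%:R * C * `|x - y|.
Proof.
move=> dg gC xr yr.
pose z (k : nat) : Rd := \row_j (if (j < k)%N then x ord0 j else y ord0 j).
have zr k : `|z k| <= r.
  apply/rV_norm_leP; split=> [|j]; first exact: le_trans xr.
  by rewrite mxE; case: ifP => _; rewrite (le_trans (rV_norm_coord _ _)).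
have -> : g x - g y = \sum_(k < d) (g (z k.+1) - g (z k)).
  rewrite -(big_mkord xpredT (fun k => g (z k.+1) - g (z k))) telescope_sumr//.
  congr (g _ - g _); apply/rowP => j; rewrite mxE//.
  by rewrite ltn_ord.
rewrite (le_trans (ler_norm_sum _ _ _))//.
rewrite (@le_trans _ _ (\sum_(k < d) C * `|x - y|))//; last first.
  by rewrite sumr_const card_ord -mulrA mulr_natl.
apply: ler_sum => k _.
have -> : z k.+1 = (x ord0 k - y ord0 k) *: e_ k + z k.
  apply/rowP => j; rewrite !mxE eqxx/= ltnS leq_eqVlt.
  have [->|jk] := eqVneq j k; first by rewrite eqxx ltnn /= mulr1 subrK.
  by rewrite (_ : (j == k :> nat) = false) ?mulr0 ?add0r//; exact/negbTE.
have xyk : `|x ord0 k - y ord0 k| <= `|x - y|.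
  by have := rV_norm_coord (x - y) k; rewrite !mxE.
have C0 : 0 <= C.
  apply: le_trans (gC k (z k) _) => //.
  by have := zr k; have := normr_ge0 x; lra.
rewrite (le_trans (line_le (C := C) (dg k) _)) ?ler_wpM2l//.
move=> w wr; apply: gC; rewrite (le_trans wr)//.
have := zr k; have := ler_normB x y; lra.
Qed.

Lemma taylor1_of_partials g C r i x t :
  (forall j z, derivable g z (e_ j)) ->
  (forall j z, derivable (partial i g) z (e_ j)) ->
  (forall j z, `|z| <= 3 * r -> `|partial j (partial i g) z| <= C) ->
  `|x| + `|t| <= r ->
  `|g (t *: e_ i + x) - g x - t * partial i g x| <= d%:R * C * `|t| ^+ 2.
Proof.
move=> dg ddg gC xtr.
pose F (s : R) := g (s *: e_ i + x) - s * partial i g x.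
have := @mean_value_le F (fun s => partial i g (s *: e_ i + x) - partial i g x)
  (d%:R * C * `|t|) t.
rewrite /F scale0r mul0r subr0 add0r expr2 mulrA addrAC; apply=> [s|s st].
  have D1 := is_derive_line (dg i (s *: e_ i + x)).
  have D2 := is_deriveM (is_derive_id s 1) (is_derive_cst (partial i g x) s 1).
  by apply: is_derive_eq; rewrite scaler0 add0r [_ *: 1]mulr1.
have nse : `|s *: e_ i| <= `|s|.
  by rewrite normrZ -[leRHS]mulr1 ler_pM// norm_delta_le1.
have C0 : 0 <= C.
  apply: le_trans (gC i 0 _) => //; rewrite normr0.
  by have := normr_ge0 x; have := normr_ge0 t; lra.
rewrite (le_trans (lipschitz_of_partials ddg gC _ _))//.
- rewrite (le_trans (ler_normD _ _))//; lra.
- by have := normr_ge0 t; lra.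
- by rewrite addrK ler_wpM2l ?mulr_ge0// (le_trans nse).
Qed.

End mean_value.

(** * Limits of convolutions along an ultrafilter *)

Lemma fmap_ultra (T U : Type) (f : T -> U) (F : set_system T) :
  UltraFilter F -> UltraFilter (f @ F).
Proof.
move=> UF; split=> [|G PG sFG]; first exact: fmap_proper_filter.
apply/seteqP; split=> [A GA|]; last exact: sFG.
have [//|FnA] := in_ultra_setVsetC (f @^-1` A) UF.
have /filter_ex[y [Ay]] : G (A `&` ~` A) by apply: filterI => //; exact: sFG.
by case.
Qed.

(** The image of the ultrafilter contains a compact interval. *)
Lemma ultra_bounded_cvg (R : realType) (T : Type) (F : set_system T)
    (h : T -> R) (C : R) : UltraFilter F ->
  (\forall u \near F, `|h u| <= C) -> cvg (h @ F).
Proof.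
move=> UF hC; have := @segment_compact R (- C) C; rewrite compact_ultra.
move=> /(_ (h @ F) (fmap_ultra h UF))[|l [_ hl]]; last first.
  by apply/cvg_ex; exists l.
by apply: filterS hC => u; rewrite /= in_itv/= ler_norml.
Qed.

Section pairing_bound.
Variables (R : realType) (d : nat).
Notation Rd := 'rV[R]_d.
Implicit Types (f u phi : Rd -> R).

(** Continuity of the functional [phi |-> \int u phi] on the test functions
    supported in the ball of radius [r].  The same integer serves as the order,
    the size of the neighbourhood of 0 and the bound, so that overspill applies
    to it. *)
Definition bounded_pairing (r : R) (n : nat) u : Prop :=
  forall phi, Cinf phi -> vanishes_off r phi ->
    (forall a : 'I_d -> nat, (forall i, a i <= n)%N ->
      forall x, `|multi_partial a phi x| <= n.+1%:R^-1) ->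
    `|integral_Rd (fun x => u x * phi x)| <= n%:R.

(** The functions [f (x - .)] with [`|x| <= rho] have a common compact support
    and common bounds on their derivatives. *)
Lemma convolution_bounded f r rho n : Cinfc f -> vanishes_off r f ->
  exists C, forall u, continuous u -> bounded_pairing (r + rho) n u ->
    forall x, `|x| <= rho -> `|convolution u f x| <= C.
Proof.
move=> cf fr; have [M M0 fM] := multi_partials_bounded n cf.
(* This factor brings the derivatives of [f] of order at most [n] in each
   variable down to 1 / (n + 1). *)
pose k := (M * n.+1%:R)^-1.
have k0 : 0 < k by rewrite invr_gt0 mulr_gt0.
exists (n%:R / k) => u cu bu x xrho; have [Cf _] := cf.
have := bu (fun y => k * f (x - y)) (Cinf_reflect k x Cf).
have -> : integral_Rd (fun y => u y * (k * f (x - y))) = k * convolution u f x.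
  rewrite convolutionC//; last exact: Cinfc_Cc.
  rewrite -integral_RdZ; first by under eq_fun do rewrite mulrCA (mulrC (u _)).
  under eq_fun do rewrite mulrC.
  by apply: CcMr => //; apply: Cc_reflect; exact: Cinfc_Cc.
rewrite normrM gtr0_norm// ler_pdivlMr// mulrC; apply.
  move=> y ry; rewrite (vanishes_off_reflect fr) ?mulr0//.
  by rewrite (le_lt_trans _ ry)// lerD2l.
move=> a an y; have [k' k'k ->] := multi_partial_reflect k x a Cf.
have kE : k = n.+1%:R^-1 / M by rewrite /k invfM mulrC.
rewrite normrM k'k (gtr0_norm k0) kE -mulrA ler_piMr// ?invr_ge0//.
by rewrite mulrC ler_pdivrMr// mul1r fM.
Qed.

(** Integration by parts, written for a differential operator. *)
Lemma convolution_pdo m c u f x : Cinf u -> Cinfc f ->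
  convolution f (pdo m c u) x =
  \sum_(a : {ffun 'I_d -> 'I_m.+1} | (\sum_i a i <= m)%N)
    c (fun i => a i) * convolution u (multi_partial (fun i => a i) f) x.
Proof.
move=> Cu cf.
have Cma (a : 'I_d -> nat) : continuous (multi_partial a u).
  apply: Cinf_continuous; apply: (@multi_partial_ind _ _ (@Cinf R d)) => // i g.
  exact: Cinf_partial.
have Cca (a : 'I_d -> nat) : Cc (fun y => f (x - y) * multi_partial a u y).
  under eq_fun do rewrite mulrC.
  by apply: CcMr => //; apply: Cc_reflect; exact: Cinfc_Cc.
rewrite [LHS]/convolution /pdo; under eq_fun do rewrite mulr_sumr.
rewrite integral_Rd_sum => [|a].
  apply: eq_bigr => a _.
  under eq_fun do rewrite mulrCA.
  rewrite integral_RdZ//; congr (_ * _).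
  rewrite -[LHS]/(convolution f (multi_partial (fun i => a i) u) x).
  rewrite (multi_partial_convolution _ Cu cf).
  by rewrite (convolutionC (Cma _) (Cinfc_Cc cf)).
under eq_fun do rewrite mulrCA.
by apply: CcMr => //; exact: cst_continuous.
Qed.

End pairing_bound.

Lemma ltr_mul_of_div (R : realFieldType) (C t e : R) :
  0 <= t -> t < e / (`|C| + 1) -> C * t < e.
Proof.
move=> t0; rewrite ltr_pdivlMr ?ltr_wpDl// mulrC; apply: le_lt_trans.
by rewrite ler_wpM2r// (le_trans (ler_norm _))// lerDl.
Qed.

(** The ultrafilter [F] stands for an internal function, and its elements for
    the standard properties of that function. *)
Section limit_of_convolutions.
Variables (R : realType) (d : nat).
Notation Rd := 'rV[R]_d.
Notation e_ i := (delta_mx 0 i : Rd).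
Variable F : set_system (Rd -> R).
Context {UF : UltraFilter F}.
Hypothesis smoothF : \forall u \near F, Cinf u.
Hypothesis boundF :
  forall r, exists n, \forall u \near F, bounded_pairing r n u.
Implicit Types (f g u : Rd -> R) (x y : Rd) (i : 'I_d) (rho C t : R).

Lemma near_bounded f rho : Cinfc f -> exists C, \forall u \near F,
  forall x, `|x| <= rho -> `|convolution u f x| <= C.
Proof.
move=> cf; have [r fr] := Cinfc_vanishes cf; have [n bF] := boundF (r + rho).
have [C fC] := convolution_bounded rho n cf fr; exists C.
by apply: filterS2 smoothF bF => u /Cinf_continuous cu /(fC u cu).
Qed.

(** [partial i f] is a test function like [f]; the bound is uniform in [i]
    because there are finitely many coordinates. *)
Lemma near_partials_bounded f rho : Cinfc f -> exists C, \forall u \near F,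
  forall i x, `|x| <= rho -> `|convolution u (partial i f) x| <= C.
Proof.
move=> cf.
have [C FC] := choice (fun i => near_bounded rho (Cinfc_partial i cf)).
have FaC : \forall u \near F, forall i x, `|x| <= rho ->
    `|convolution u (partial i f) x| <= C i by exact: filter_forall.
exists (\sum_i `|C i|); apply: filterS FaC => u uC i x /(uC i) xC.
rewrite (le_trans xC)// (le_trans (ler_norm _))//.
by rewrite (bigD1 i)//= lerDl sumr_ge0.
Qed.

Lemma near_lipschitz f rho : Cinfc f -> exists C, \forall u \near F,
  forall x y, `|x| <= rho -> `|y| <= rho ->
    `|convolution u f x - convolution u f y| <= C * `|x - y|.
Proof.
move=> cf; have [C FC] := near_partials_bounded (3 * rho) cf.
exists (d%:R * C); apply: filterS2 smoothF FC => u Cu uC x y xr yr.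
have D i z := is_derive_convolutionr i z (Cinf_continuous Cu) cf.
apply: lipschitz_of_partials xr yr => [i z|i z zr]; first exact: ex_derive.
by rewrite /partial derive_val; exact: uC.
Qed.

(** The second derivatives of [u * f] are the convolutions of [u] with the
    second derivatives of [f], hence locally bounded uniformly in [u]. *)
Lemma near_taylor1 f i rho : Cinfc f -> exists C, \forall u \near F,
  forall x t, `|x| + `|t| <= rho ->
    `|convolution u f (t *: e_ i + x) - convolution u f x -
      t * convolution u (partial i f) x| <= C * `|t| ^+ 2.
Proof.
move=> cf; have cif := Cinfc_partial i cf.
have [C FC] := near_partials_bounded (3 * rho) cif.
exists (d%:R * C); apply: filterS2 smoothF FC => u Cu uC x t xtr.
have D j z := is_derive_convolutionr j z (Cinf_continuous Cu) cf.
have Di j z := is_derive_convolutionr j z (Cinf_continuous Cu) cif.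
have E : partial i (convolution u f) = convolution u (partial i f).
  by apply/funext => z; exact: derive_val.
rewrite -E; apply: taylor1_of_partials xtr => [j z|j z|j z zr].
- exact: ex_derive.
- by rewrite E; exact: ex_derive.
- by rewrite E /partial derive_val; exact: uC.
Qed.

Definition limit_convolution f x : R := lim (convolution u f x @[u --> F]).
Local Notation v_ := limit_convolution.

Lemma cvg_limit_convolution f x : Cinfc f ->
  convolution u f x @[u --> F] --> v_ f x.
Proof.
move=> cf; have [C FC] := near_bounded `|x| cf.
suff : cvg (convolution u f x @[u --> F]) by [].
by apply: (@ultra_bounded_cvg _ _ _ _ C); apply: filterS FC => u; exact.
Qed.

Lemma limit_norm_le (h : (Rd -> R) -> R) l C :
  h @ F --> l -> (\forall u \near F, `|h u| <= C) -> `|l| <= C.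
Proof.
move=> hl hC; have cl : closed [set s : R | s <= C] by exact: closed_le.
exact: (@closed_cvg _ _ F _ (fun u => `|h u|) (fun s => s <= C) cl hC _
  (cvg_norm hl)).
Qed.

Lemma limit_lipschitz f rho : Cinfc f -> exists C, forall x y,
  `|x| <= rho -> `|y| <= rho -> `|v_ f x - v_ f y| <= C * `|x - y|.
Proof.
move=> cf; have [C FC] := near_lipschitz rho cf; exists C => x y xr yr.
have cv z := @cvg_limit_convolution f z cf.
apply: limit_norm_le (cvgB (cv x) (cv y)) _.
by apply: filterS FC => u; exact.
Qed.

Lemma limit_taylor1 f i rho : Cinfc f -> exists C, forall x t,
  `|x| + `|t| <= rho ->
  `|v_ f (t *: e_ i + x) - v_ f x - t * v_ (partial i f) x| <= C * `|t| ^+ 2.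
Proof.
move=> cf; have [C FC] := near_taylor1 i rho cf; exists C => x t xtr.
have cv g z : Cinfc g -> _ := @cvg_limit_convolution g z.
apply: limit_norm_le (cvgB (cvgB (cv _ _ cf) (cv _ _ cf))
  (cvgM (cvg_cst t) (cv _ x (Cinfc_partial i cf)))) _.
by apply: filterS FC => u; exact.
Qed.

Lemma limit_continuous f : Cinfc f -> continuous (v_ f).
Proof.
move=> cf x; have [C vC] := limit_lipschitz (`|x| + 1) cf.
apply/(@cvgrPdist_lt _ _ _ (nbhs x)) => e e0.
have C0 : 0 < `|C| + 1 by rewrite ltr_wpDl.
near=> y.
have xy1 : `|x - y| < 1 by near: y; apply: cvgr_dist_lt => //; exact: cvg_id.
have xye : `|x - y| < e / (`|C| + 1).
  by near: y; apply: cvgr_dist_lt; [exact: cvg_id|exact: divr_gt0].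
rewrite (le_lt_trans (vC _ _ _ _))//; first by rewrite lerDl.
  by have := lerB_dist y x; rewrite distrC; move: xy1; lra.
exact: ltr_mul_of_div.
Unshelve. all: by end_near. Qed.

(** The quadratic remainder in [limit_taylor1] controls the difference
    quotients. *)
Lemma limit_is_derive f i x : Cinfc f ->
  is_derive x (e_ i) (v_ f) (v_ (partial i f) x).
Proof.
move=> cf; have [C vC] := limit_taylor1 i (`|x| + 1) cf.
suff cv : (t : R)^-1 *: ((v_ f \o shift x) (t *: e_ i) - v_ f x)
    @[t --> 0^'] --> v_ (partial i f) x.
  by apply: DeriveDef; [apply/cvg_ex; eexists; exact: cv | exact: cvg_lim].
apply/cvgrPdist_lt => e e0; have C0 : 0 < `|C| + 1 by rewrite ltr_wpDl.
near=> t.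
have t0 : t != 0 by near: t; exact: nbhs_dnbhs_neq.
have t1 : `|t| < 1 by near: t; apply: dnbhs0_lt.
have te : `|t| < e / (`|C| + 1) by near: t; apply: dnbhs0_lt; exact: divr_gt0.
have := vC x t; rewrite lerD2l => /(_ (ltW t1)) vt.
rewrite distrC /= -[X in _ - X](mulKf t0) -[_ *: _]/(_ * _) -mulrBr.
rewrite normrM normfV.
rewrite ltr_pdivrMl ?normr_gt0// (le_lt_trans vt)// expr2 mulrA mulrC.
rewrite ltr_pM2l ?normr_gt0//.
exact: ltr_mul_of_div.
Unshelve. all: by end_near. Qed.

Lemma limit_Cinf f : Cinfc f -> Cinf (v_ f).
Proof.
move=> cf; apply: (@Cinf_coind _ _ [set g | exists2 h, Cinfc h & g = v_ h]).
  move=> _ [h ch ->]; split; first exact: limit_continuous.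
  move=> i; have D x := limit_is_derive i x ch.
  split=> [x|]; first exact: ex_derive.
  exists (partial i h); first exact: Cinfc_partial.
  by apply/funext => x; exact: derive_val.
by exists f.
Qed.

(** Pointwise convergence of an equicontinuous family is uniform on compact
    sets. *)
Lemma limit_uniform f rho e : Cinfc f -> 0 < e -> \forall u \near F,
  forall x, `|x| <= rho -> `|convolution u f x - v_ f x| < e.
Proof.
move=> cf e0; have [C FC] := near_lipschitz (rho + 1) cf.
have C0 : 0 < `|C| + 1 by rewrite ltr_wpDl.
have e3 : 0 < e / 3 by rewrite divr_gt0.
have /compact_near_coveringP cov := @compact_norm_le R d rho.
apply: (cov _ F (fun u x => `|convolution u f x - v_ f x| < e)) => x /= xr.
near=> y u => /=.
have xy1 : `|x - y| < 1 by near: y; apply: cvgr_dist_lt => //; exact: cvg_id.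
have xye : `|x - y| < e / 3 / (`|C| + 1).
  by near: y; apply: cvgr_dist_lt; [exact: cvg_id|exact: divr_gt0].
have yr : `|y| <= rho + 1.
  by have := lerB_dist y x; rewrite distrC; move: xy1 xr; lra.
have uxy : `|convolution u f y - convolution u f x| < e / 3.
  have uL : forall x y, `|x| <= rho + 1 -> `|y| <= rho + 1 ->
    `|convolution u f x - convolution u f y| <= C * `|x - y| by near: u.
  rewrite (le_lt_trans (uL _ _ _ _))// ?(le_trans xr) ?lerDl// distrC.
  exact: ltr_mul_of_div.
have ux : `|v_ f x - convolution u f x| < e / 3.
  by near: u; apply: cvgr_dist_lt => //; exact: cvg_limit_convolution.
have vxy : `|v_ f x - v_ f y| < e / 3.
  by near: y; apply: cvgr_dist_lt => //; exact: limit_continuous.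
rewrite (_ : _ - _ = (convolution u f y - convolution u f x) -
  (v_ f x - convolution u f x) + (v_ f x - v_ f y)); last by ring.
rewrite (le_lt_trans (ler_normD _ _))//.
rewrite (_ : e = e / 3 + e / 3 + e / 3); last by field.
by rewrite ltrD// (le_lt_trans (ler_normB _ _))// ltrD.
Unshelve. all: by end_near. Qed.

(** Both sides are limits of the same numbers: [P v] because differentiation
    commutes with the limit, [f] by hypothesis after an integration by parts. *)
Lemma limit_pdo m c f : Cinfc f ->
  (forall x, convolution f (pdo m c u) x @[u --> F] --> f x) ->
  pdo m c (v_ f) = f.
Proof.
move=> cf fundF; apply/funext => x.
have vE a : multi_partial a (v_ f) = v_ (multi_partial a f).
  pose Q g h := Cinfc h /\ g = v_ h.
  suff [] : Q (multi_partial a (v_ f)) (multi_partial a f) by [].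
  apply: multi_partial_rel => // i _ h [ch ->].
  split; first exact: Cinfc_partial.
  by apply/funext => z; have D := limit_is_derive i z ch; exact: derive_val.
have ca a : Cinfc (multi_partial a f).
  apply: (@multi_partial_ind _ _ (@Cinfc R d)) => // i g.
  exact: Cinfc_partial.
apply: (@cvg_unique _ (@norm_hausdorff _ R)
  (convolution f (pdo m c u) x @[u --> F])); last exact: fundF.
pose S u := \sum_(a : {ffun 'I_d -> 'I_m.+1} | (\sum_i a i <= m)%N)
    c (fun i => a i) * convolution u (multi_partial (fun i => a i) f) x.
suff SF : S u @[u --> F] --> pdo m c (v_ f) x.
  apply: cvg_trans SF; apply: near_eq_cvg.
  by apply: filterS smoothF => u Cu; rewrite /S -convolution_pdo.
rewrite /pdo; apply: cvg_big => [|a _]; first exact: add_continuous.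
apply: cvgM; first exact: cvg_cst.
by rewrite vE; exact: cvg_limit_convolution.
Qed.

End limit_of_convolutions.

(** * Transfer and overspill *)

Section transfer.
Variable N : nonstandard_extension.
Implicit Types A B C : Type.

Lemma sset_mono A (P Q : set A) (X : N A) : P `<=` Q -> sset P X -> sset Q X.
Proof. by move=> PQ; rewrite -(setIidl PQ) => /sset_setI[]. Qed.

Lemma sset0 A (X : N A) : ~ sset set0 X.
Proof.
by rewrite -(setICr set0) => /sset_setI[s0 /sset_setC].
Qed.

Lemma ssetT A (X : N A) : sset setT X.
Proof. by rewrite -setC0; apply/sset_setC; exact: sset0. Qed.

(** The standard properties of an internal element determine limits along it:
    the value of [smap h X] is infinitely close to the limit of [h] along this
    ultrafilter, when it exists. *)
Definition star_filter A (X : N A) : set_system A := [set P | sset P X].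

#[export] Instance star_filter_ultra A (X : N A) : UltraFilter (star_filter X).
Proof.
split=> [|G GF sXG].
  split; first exact: sset0.
  split; first exact: ssetT.
    by move=> P Q ? ?; apply/sset_setI.
  by move=> P Q; exact: sset_mono.
apply/seteqP; split=> [P GP|]; last exact: sXG.
apply: contrapT => /sset_setC /sXG GnP.
by have /filter_ex[x []] : G (P `&` ~` P) by exact: filterI.
Qed.

Lemma sset_smap A B (f : A -> B) (P : set B) (X : N A) :
  sset P (smap f X) = sset [set a | P (f a)] X.
Proof. by apply/propext; apply: iff_sym; exact: sset_preimage. Qed.

(** The constant function factors through [unit], whose extension has only one
    point. *)
Lemma smap_cst A B (X : N A) (b : B) : smap (fun=> b) X = std b.
Proof.
have unitE (t : N unit) : t = std tt.
  by apply/sset_eq; apply: sset_mono (ssetT _) => -[[] []].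
rewrite -[fun=> b]/((fun=> b) \o (fun=> tt)) smap_comp.
by rewrite [smap _ X]unitE smap_std.
Qed.

Lemma smap_pair A B C (f : A -> B) (g : A -> C) (X : N A) :
  spair (smap f X) (smap g X) = smap (fun a => (f a, g a)) X.
Proof. by rewrite -[RHS]spair_eta -!smap_comp. Qed.

Lemma smap2_smap A B C D (h : B -> C -> D) (f : A -> B) (g : A -> C) (X : N A) :
  smap2 h (smap f X) (smap g X) = smap (fun a => h (f a) (g a)) X.
Proof. by rewrite /smap2 smap_pair -smap_comp. Qed.

Lemma sapp_smap A B C (f : A -> B -> C) (g : A -> B) (X : N A) :
  sapp (smap f X) (smap g X) = smap (fun a => f a (g a)) X.
Proof. exact: smap2_smap. Qed.

Lemma eq_smapP A B (f g : A -> B) (X : N A) :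
  smap f X = smap g X <-> sset [set a | f a = g a] X.
Proof. by rewrite -sset_eq smap_pair sset_smap. Qed.

Lemma eq_stdP A (x : N A) (a : A) : x = std a <-> sset [set b | b = a] x.
Proof. by rewrite -[x in x = _]smap_id -(smap_cst x a) eq_smapP. Qed.

(** No nonstandard integer lies below a standard one, by induction on the
    latter. *)
Lemma infinite_nat (n : N nat) : (forall k : nat, n <> std k) ->
  forall k : nat, sset [set j | (k <= j)%N] n.
Proof.
move=> nstd; elim=> [|k IH]; first exact: sset_mono (ssetT n).
apply: contrapT => /sset_setC nk; apply: (nstd k); apply/eq_stdP.
have /sset_mono : sset ([set j | (k <= j)%N] `&` ~` [set j | (k < j)%N]) n.
  exact/sset_setI.
apply=> j [/= kj /negP]; rewrite -leqNgt => jk.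
by apply/eqP; rewrite eqn_leq jk.
Qed.

(** Either [P] fails somewhere, and then it fails right after some [n] where it
    holds, which cannot be standard; or it holds everywhere, in particular at
    a nonstandard integer of the extension. *)
Lemma overspill A (w : N A) (P : set (A * nat)) :
  (forall k : nat, sset [set a | P (a, k)] w) ->
  exists2 n : N nat, (forall k : nat, sset [set j | (k <= j)%N] n) &
    sset P (spair w n).
Proof.
move=> Pstd.
have [/sset_exists[n Pn]|/sset_setC nP] := pselect
  (sset [set a | exists k,
    [set p : A * nat | P p /\ ~ P (p.1, p.2.+1)] (a, k)] w).
  exists n; last by apply: sset_mono Pn => p [].
  apply: infinite_nat => k nk; move: Pn; rewrite nk -(smap_cst w k).
  rewrite -[w in spair w _]smap_id smap_pair sset_smap => Pn.
  apply: (@sset0 _ w); move/sset_setI: (conj Pn (Pstd k.+1)).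
  by apply: sset_mono => a [[/= _ nPk] Pk].
have [n /infinite_nat nN] := star_proper N; exists n => //.
have : sset [set a | forall k, P (a, k)] w.
  move/sset_setI: (conj nP (Pstd 0%N)); apply: sset_mono => a [/= nPa P0].
  by elim=> // k IH; apply: contrapT => nPk; apply: nPa; exists k.
rewrite -[w in sset _ w](smap_fst w n) sset_smap.
by apply: sset_mono => -[a k] /=; exact.
Qed.

Section numbers.
Variables (R : realType) (V : normedZmodType R).

Lemma finite_smapP A (f : A -> V) (X : N A) :
  finite_elt (smap f X) <-> exists r : R, sset [set a | `|f a| <= r] X.
Proof.
rewrite /finite_elt /sle /snorm -smap_comp.
by split=> -[r Xr]; exists r; move: Xr;
  rewrite -(smap_cst X r) smap_pair sset_smap.
Qed.

Lemma approx_smapP A (f g : A -> V) (X : N A) :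
  Defs.approx (smap f X) (smap g X) <->
  forall e : R, 0 < e -> sset [set a | `|f a - g a| < e] X.
Proof.
rewrite /Defs.approx /infinitesimal /slt /snorm smap2_smap -smap_comp.
by split=> Xe e /Xe; rewrite -(smap_cst X e) smap_pair sset_smap.
Qed.

Lemma finite_std (v : V) : finite_elt (std v : N V).
Proof.
rewrite -(smap_cst (std v) v); apply/finite_smapP; exists `|v|.
by apply: sset_mono (ssetT (std v)) => u _ /=.
Qed.

End numbers.

End transfer.

(** * Nonstandard fundamental solutions *)

Section nonstandard_fundamental_solution.
Variables (N : nonstandard_extension) (R : realType) (d : nat).
Notation Rd := 'rV[R]_d.

Lemma multi_partial0 (a : 'I_d -> nat) :
  multi_partial a ((fun=> 0) : Rd -> R) = fun=> 0.
Proof.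
apply: (@multi_partial_ind _ _ (fun g => g = fun=> 0)) => // i _ ->.
by apply/funext => x; rewrite /partial derive_cst.
Qed.

Lemma Cinfc0 : Cinfc ((fun=> 0) : Rd -> R).
Proof.
apply: (@CinfcI _ _ _ 0) => //.
apply: (@Cinf_coind _ _ [set g | g = fun=> 0]) => // g ->; split.
  exact: cst_continuous.
move=> i; split=> [x|]; first exact: derivable_cst.
by apply/funext => x; rewrite /partial derive_cst.
Qed.

(** Otherwise there are, by overspill, an infinite [n] and a test function [phi]
    supported in the standard ball of radius [r] whose derivatives of order at
    most [n] in each variable are bounded by 1 / (n + 1), while its pairing with
    [E] exceeds [n].  Such a [phi] is infinitely close to 0, hence
    nearstandard. *)
Lemma Dprime_bounded_pairing (E : N (Rd -> R)) (r : R) : Dprime E ->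
  exists n, sset (bounded_pairing r n) E.
Proof.
move=> [_ Efin]; apply: contrapT => nbd.
have [k|n ninf nbdn] := @overspill N _ E [set p | ~ bounded_pairing r p.2 p.1].
  by apply/sset_setC => bd; apply: nbd; exists k.
pose bad (p : (Rd -> R) * nat * (Rd -> R)) := [/\ Cinf p.2, vanishes_off r p.2,
  (forall a : 'I_d -> nat, (forall i, a i <= p.1.2)%N ->
    forall x, `|multi_partial a p.2 x| <= p.1.2.+1%:R^-1) &
  p.1.2%:R < `|integral_Rd (fun x => p.1.1 x * p.2 x)|].
have /sset_exists[phi badphi] :
    sset [set p | exists phi, bad (p, phi)] (spair E n).
  apply: sset_mono nbdn => -[u k] /= nb; apply: contrapT => nex; apply: nb.
  move=> phi Cphi phir phia; rewrite leNgt; apply/negP => kphi.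
  by apply: nex; exists phi.
set X := spair _ phi in badphi.
have EX : E = smap (fun p => p.1.1) X.
  by rewrite -[fun p => _]/(fst \o fst) smap_comp !smap_fst.
have phiX : phi = smap snd X by rewrite smap_snd.
have nX : n = smap (fun p => p.1.2) X.
  by rewrite -[fun p => _]/(snd \o fst) smap_comp smap_fst smap_snd.
have ninfX k : sset [set p : (Rd -> R) * nat * (Rd -> R) | (k <= p.1.2)%N] X.
  by have := ninf k; rewrite nX sset_smap.
have nsphi : nearstandard_Cinfc phi.
  split; first by rewrite phiX sset_smap; apply: sset_mono badphi => p [].
  exists (fun=> 0); split; first exact: Cinfc0.
  split=> [a x _|x xinf]; set Y := spair X x;
    have XY : X = smap fst Y by rewrite smap_fst.
    have xY : x = smap snd Y by rewrite smap_snd.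
    rewrite phiX XY xY -(smap_cst Y) -!smap_comp !sapp_smap.
    apply/approx_smapP => e e0.
    have [k0 k0e] : exists k : nat, k.+1%:R^-1 < e.
      have [k _ /(_ k (leqnn k))] := near_infty_natSinv_lt (PosNum e0).
      by exists k.
    (* Above this standard integer, [a] is among the orders that are controlled
       and the bound on the derivatives is below [e]. *)
    pose k := maxn k0 (\max_i a i).
    have := conj badphi (ninfX k) => /sset_setI; rewrite XY sset_smap.
    apply: sset_mono => -[p y] [/= [_ _ pa _] kp].
    rewrite multi_partial0 subr0 (le_lt_trans (pa a _ y))//.
      by move=> i; rewrite (leq_trans _ kp)// leq_max leq_bigmax orbT.
    rewrite (le_lt_trans _ k0e)// lef_pV2 ?posrE// ler_nat ltnS.
    by rewrite (leq_trans _ kp)// leq_maxl.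
  have xY : x = smap snd Y by rewrite smap_snd.
  rewrite phiX XY xY -(smap_cst Y) -!smap_comp !sapp_smap.
  apply/eq_smapP.
  have /sset_setC : ~ sset [set y | `|y| <= r] x.
    move=> xr; apply: xinf; rewrite -[x]smap_id.
    by apply/finite_smapP; exists r.
  rewrite xY sset_smap => xr.
  move: badphi; rewrite XY sset_smap => badphi.
  move: (conj badphi xr) => /sset_setI.
  apply: sset_mono => -[p y] [/= [_ pr _ _]].
  by move=> /negP; rewrite -ltNge => /pr.
have := Efin phi nsphi; rewrite /spairing EX phiX smap2_smap.
move=> /finite_smapP[C XC].
have [k Ck] : exists k : nat, C < k%:R.
  by exists (Num.bound `|C|); rewrite (le_lt_trans (ler_norm _))// archi_boundP.
apply: (@sset0 N _ X).
move: (conj (conj badphi (ninfX k)) XC) => [/sset_setI bX CX].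
move: (conj bX CX) => /sset_setI.
apply: sset_mono => p [[/= [_ _ _ np] kp] pC].
have : k%:R <= p.1.2%:R :> R by rewrite ler_nat.
by move: np pC Ck; lra.
Qed.

Lemma cvg_star_filter A (X : N A) (h : A -> R) (l : R) :
  Defs.approx (smap h X) (std l) -> h @ star_filter X --> l.
Proof.
rewrite -(smap_cst X l) => /approx_smapP hl; apply/cvgrPdist_lt => e /hl.
by apply: sset_mono => a /=; rewrite distrC.
Qed.

Lemma approx_std_refl A (V : normedZmodType R) (f : A -> V) (X : N A) :
  Defs.approx (smap f X) (smap f X).
Proof.
apply/approx_smapP => e e0; apply: sset_mono (ssetT X) => a _ /=.
by rewrite subrr normr0.
Qed.

Lemma nearstandard_std (g : Rd -> R) :
  Cinfc g -> nearstandard_Cinfc (@std N _ g).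
Proof.
move=> cg; split; first by apply/sset_std; case: cg.
exists g; split=> //; split=> // a x _; rewrite -(smap_cst x) -smap_comp.
rewrite -[X in sapp _ X]smap_id sapp_smap; exact: approx_std_refl.
Qed.

(** The function [f (x - .)] is a standard test function, which takes the value
    [f x] at the origin. *)
Lemma fundamental_solution_cvg m c (E : N (Rd -> R)) (f : Rd -> R) (x : Rd) :
  fundamental_solution m c E -> Cinfc f ->
  convolution f (pdo m c u) x @[u --> star_filter E] --> f x.
Proof.
move=> [_ [_ delta]] cf; apply: cvg_star_filter.
have cg : Cinfc (fun y => f (x - y)).
  have [r fr] := Cinfc_vanishes cf.
  apply: (CinfcI _ (vanishes_off_reflect fr)).
  have := Cinf_reflect 1 x cf.1; congr Cinf.
  by apply/funext => y; rewrite mul1r.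
have := delta _ (nearstandard_std cg).
rewrite /spairing -(smap_cst E (fun y => f (x - y))) smap2_smap.
by rewrite -(smap_cst E (0 : Rd)) sapp_smap subr0 smap_cst.
Qed.

(** Once [E] and the point are written as images of one internal [X], a property
    of the values of [E * f] becomes a set in the ultrafilter of [X]. *)
Lemma sconvolution_smap (E : N (Rd -> R)) (f : Rd -> R) A (X : N A)
    (u : A -> Rd -> R) (p : A -> Rd) :
  E = smap u X ->
  sapp (sconvolution E (std f)) (smap p X) =
  smap (fun a => convolution (u a) f (p a)) X.
Proof.
by move=> ->; rewrite /sconvolution -(smap_cst X f) smap2_smap sapp_smap.
Qed.

End nonstandard_fundamental_solution.

Theorem theorem33 (N : nonstandard_extension) (R : realType) (d m : nat)
    (c : ('I_d -> nat) -> R) (E : N ('rV[R]_d -> R)) (f : 'rV[R]_d -> R) :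
  Dprime E -> fundamental_solution m c E -> Cinfc f ->
  let F := sapp (sconvolution E (std f)) in
  let v := standard_part F in
  [/\ has_standard_part F, is_standard_part F v, Cinf v & pdo m c v = f].
Proof.
move=> DE fundE cf F v.
have smoothE : \forall u \near star_filter E, Cinf u by case: DE.
have boundE r : exists n, \forall u \near star_filter E, bounded_pairing r n u.
  exact: Dprime_bounded_pairing.
pose w := limit_convolution (star_filter E) f.
have cw : continuous w by exact: limit_continuous.
have Fw : is_standard_part F w.
  split=> [|x xfin]; first exact: cw.
  set X := spair E x.
  have EX : E = smap fst X by rewrite smap_fst.
  have xX : x = smap snd X by rewrite smap_snd.
  have [r xr] : exists r : R, sset [set p | `|p.2| <= r] X.
    by apply/finite_smapP; rewrite -xX.
  rewrite xX /F (sconvolution_smap _ _ EX) -(smap_cst X w) sapp_smap.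
  apply/approx_smapP => e e0.
  have : sset [set u | forall z, `|z| <= r ->
    `|convolution u f z - w z| < e] E by exact: limit_uniform.
  rewrite [in X in X -> _]EX sset_smap => unif.
  move: (conj unif xr) => /sset_setI; apply: sset_mono => -[u y] [/=]; exact.
have wE : v = w.
  apply: xget_unique => // g [cg Fg]; apply/funext => x.
  (* A standard part is a pointwise limit along [E], hence unique. *)
  have cvgFx (h : 'rV[R]_d -> R) : is_standard_part F h ->
      convolution u f x @[u --> star_filter E] --> h x.
    move=> [_ /(_ (std x) (finite_std N x))]; rewrite /F -(smap_cst E x).
    rewrite (sconvolution_smap _ _ (esym (smap_id E))).
    rewrite -(smap_cst E h) sapp_smap.
    by rewrite (smap_cst E (h x)); exact: cvg_star_filter.
  exact: (cvg_unique _ (cvgFx _ (conj cg Fg)) (cvgFx _ Fw)).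
split; [|by rewrite wE|by rewrite wE; exact: limit_Cinf|].
- move=> x; split=> [y yx|].
    (* A point infinitely close to [x] is at distance less than 1 from it, hence
       in the ball where the Lipschitz estimate holds. *)
    have [C EC] := near_lipschitz smoothE boundE (`|x| + 1) cf.
    have C0 : 0 < `|C| + 1 by rewrite ltr_wpDl.
    set X := spair E y.
    have EX : E = smap fst X by rewrite smap_fst.
    have yX : y = smap snd X by rewrite smap_snd.
    move: yx; rewrite /F yX -(smap_cst X x) => /approx_smapP yx.
    rewrite !(sconvolution_smap _ _ EX); apply/approx_smapP => e e0.
    move: (EC : sset _ E); rewrite [in X in X -> _]EX sset_smap => XC.
    have e'0 : 0 < e / (`|C| + 1) by exact: divr_gt0.
    move: (conj (conj (yx _ ltr01) (yx _ e'0)) XC) => [/sset_setI yx' {}XC].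
    move: (conj yx' XC) => /sset_setI.
    apply: sset_mono => -[u z] [[/= z1 ze] uC].
    rewrite (le_lt_trans (uC _ _ _ _)) ?lerDl//.
      by have := lerB_dist z x; move: z1; lra.
    exact: ltr_mul_of_div.
  have [C EC] := near_bounded smoothE boundE `|x| cf.
  rewrite /F -(smap_cst E x) (sconvolution_smap _ _ (esym (smap_id E))).
  by apply/finite_smapP; exists C; apply: sset_mono EC => u; exact.
- by rewrite wE; apply: limit_pdo => // x; exact: fundamental_solution_cvg.
Qed.
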